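(* Let $\mathbf{A}=\{e_1,e_2\}$ be the standard basis vectors of $\mathbb{Z}^2$ and let $\mathbb{P}$ be a translation-invariant Borel probability measure on $\mathbf{A}^{\mathbb{Z}^2}$. If the entropy rate $h(\mathbb{P})$ of the $\mathbb{Z}^2$ shift system $(\mathbf{A}^{\mathbb{Z}^2},\mathbb{P},\mathbb{Z}^2)$ is positive, then not all trajectories can be bi-infinite; that is, the event $\Omega_\alpha$ that the origin is bi-infinite satisfies $\mathbb{P}(\Omega_\alpha)<1$.
   Context: The shift acts by $(T^z\omega)(x)=\omega(x+z)$. The arrow at $x\in\mathbb{Z}^2$ is $\alpha(\omega,x)=\omega(x)\in\{e_1,e_2\}$. From every $x\in\mathbb{Z}^2$ there is a directed walk $X_x(\omega,0)=x$, $X_x(\omega,k+1)=X_x(\omega,k)+\alpha(\omega,X_x(\omega,k))$. A point $z\in\mathbb{Z}^2$ is bi-infinite (in $\omega$) if there is an infinite sequence $a_1,a_2,\dots\in\mathbb{Z}^2$ with $X_{a_1}(\omega,1)=z$ and $X_{a_{n+1}}(\omega,1)=a_n$ for all $n\ge1$. The entropy rate $h(\mathbb{P})$ is the usual $\mathbb{Z}^2$-entropy: the limit, as both side lengths of a rectangle $M\subset\mathbb{Z}^2$ tend to infinity, of $|M|^{-1}$ times the Shannon entropy of the projection of $\mathbb{P}$ to $\mathbf{A}^M$. *)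

(* Defs.v *)
From HB Require Import structures.
From mathcomp Require Import all_boot all_order all_algebra.
From mathcomp Require Import finmap.
From mathcomp Require Import all_classical all_reals all_analysis.

Set Implicit Arguments.
Unset Strict Implicit.
Unset Printing Implicit Defensive.

Import Order.TTheory GRing.Theory Num.Theory.
Import numFieldNormedType.Exports.

Local Open Scope classical_set_scope.
Local Open Scope ring_scope.

Definition site : Type := (int * int)%type.

(* The alphabet {e_1, e_2} is encoded by the discrete space [bool], with
   [true] standing for e_1 = (1, 0) and [false] for e_2 = (0, 1). *)
Definition arrow : Type := bool.

Definition arrow_vec (a : arrow) : site := if a then (1, 0) else (0, 1).

(* [{ptws _ -> _}] carries the product topology. *)
Definition config : Type := {ptws site -> arrow}.

Definition borel_config :=
  g_sigma_algebraType (@open {ptws site -> arrow}).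

Definition shift (z : site) (w : config) : config := fun x => w (x + z).

Definition alpha (w : config) (x : site) : site := arrow_vec (w x).

Fixpoint walk (w : config) (x : site) (k : nat) : site :=
  if k is k'.+1 then walk w x k' + alpha w (walk w x k') else x.

(* The sequence a_1, a_2, ... is indexed from 0. *)
Definition bi_infinite (w : config) (z : site) : Prop :=
  exists a : nat -> site,
    walk w (a 0%N) 1 = z /\ forall n, walk w (a n.+1) 1 = a n.

Definition Omega_alpha : set borel_config := [set w | bi_infinite w 0].

Definition translation_invariant (R : realType)
    (P : probability borel_config R) : Prop :=
  forall (z : site) (B : set borel_config),
    measurable B -> P (shift z @^-1` B) = P B.

(* In nats; [ln 0 = 0], so that 0 ln 0 = 0 as usual. *)
Definition shannon_entropy (R : realType) (T : finType) (q : T -> R) : R :=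
  \sum_(t : T) - (q t * ln (q t)).

Definition marginal (R : realType) (P : probability borel_config R)
    (M : {fset site}) (p : {ffun M -> arrow}) : R :=
  fine (P [set w | forall x : M, w (val x) = p x]).

Definition rectangle (c : site) (m n : nat) : {fset site} :=
  [fset ((c.1 + i%:Z)%R, (c.2 + j%:Z)%R) | i in iota 0 m, j in iota 0 n]%fset.

(* The filter lets both side lengths tend to infinity, uniformly in the
   position of the lower left corner.  For a translation-invariant P the limit
   exists by subadditivity, so [lim] does not take its default value. *)
Definition entropy_rate (R : realType) (P : probability borel_config R) : R :=
  lim (shannon_entropy (@marginal R P (rectangle r.1 r.2.1 r.2.2)) /
         #|` rectangle r.1 r.2.1 r.2.2|%:R
       @[r --> filter_prod (globally [set: site]) (filter_prod \oo \oo)]).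

Lemma measurable_cylinder (x : site) (b : bool) :
  measurable ([set w | w x = b] : set borel_config).
Proof.
apply: sub_sigma_algebra.
have -> : [set w | w x = b] = (fun w : config => w x) @^-1` [set b] by [].
apply: (@open_comp {ptws site -> arrow} bool).
  by move=> w _; exact: (@proj_continuous _ (fun=> bool) x w).
exact: discrete_open.
Qed.

Fixpoint has_ancestor (w : config) (n : nat) (z : site) : Prop :=
  if n is n'.+1 then exists y, walk w y 1 = z /\ has_ancestor w n' y else True.

Lemma walk1E (w : config) (y z : site) :
  walk w y 1 = z <->
  (y = z - (1, 0) /\ w y = true) \/ (y = z - (0, 1) /\ w y = false).
Proof.
rewrite /= /alpha /arrow_vec; split.
  by case: (w y) => <-; [left|right]; rewrite addrK.
by case=> -[-> ->]; rewrite subrK.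
Qed.

Lemma has_ancestorS w n z : has_ancestor w n.+1 z -> has_ancestor w n z.
Proof.
elim: n z => [//|n ih] z [y [yz hy]].
by exists y; split=> //; exact: ih.
Qed.

Lemma has_ancestor_le w m n z :
  (m <= n)%N -> has_ancestor w n z -> has_ancestor w m z.
Proof.
move=> /subnK <-; elim: (n - m)%N => [//|k ih]; rewrite addSn.
by move=> /has_ancestorS.
Qed.

Lemma has_ancestor_step w z : (forall n, has_ancestor w n z) ->
  exists y, walk w y 1 = z /\ forall n, has_ancestor w n y.
Proof.
move=> h; apply: contrapT => hn.
have key y : walk w y 1 = z -> exists n, ~ has_ancestor w n y.
  move=> yz; apply: contrapT => hy; apply: hn; exists y; split=> // n.
  by apply: contrapT => hny; apply: hy; exists n.
have key' y : exists n, walk w y 1 = z -> ~ has_ancestor w n y.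
  have [/key[n hny]|nyz] := pselect (walk w y 1 = z); first by exists n.
  by exists 0%N.
have [n1 h1] := key' (z - (1, 0)).
have [n2 h2] := key' (z - (0, 1)).
have [y [yz hy]] := h (maxn n1 n2).+1.
have [[yE _]|[yE _]] := (walk1E w y z).1 yz; subst y.
- by apply: h1 => //; exact: has_ancestor_le (leq_maxl n1 n2) hy.
- by apply: h2 => //; exact: has_ancestor_le (leq_maxr n1 n2) hy.
Qed.

Lemma bi_infiniteP (w : config) (z : site) :
  bi_infinite w z <-> forall n, has_ancestor w n z.
Proof.
split=> [[a [a0 aS]] n|h].
  have ha k m : has_ancestor w k (a m).
    by elim: k m => [//|k ih] m; exists (a m.+1); split; [exact: aS|exact: ih].
  by case: n => [//|n]; exists (a 0%N); split=> //; exact: ha.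
have /choice[f hf] : forall y : site, exists x : site,
    (forall n, has_ancestor w n y) ->
    walk w x 1 = y /\ forall n, has_ancestor w n x.
  move=> y; have [/has_ancestor_step[x hx]|ny] :=
    pselect (forall n, has_ancestor w n y); first by exists x.
  by exists y.
have hi n : forall m, has_ancestor w m (iter n f z).
  by elim: n => [//|n /hf[]].
exists (fun n => iter n.+1 f z); split; first by have [] := hf _ h.
by move=> n; have [] := hf _ (hi n.+1).
Qed.

Lemma measurable_has_ancestor n z :
  measurable ([set w | has_ancestor w n z] : set borel_config).
Proof.
elim: n z => [|n ih] z.
  have -> : [set w | has_ancestor w 0 z] = setT by apply/seteqP; split.
  exact: measurableT.
have -> : ([set w | has_ancestor w n.+1 z] : set borel_config) =
    ([set w | w (z - (1, 0)) = true] `&` [set w | has_ancestor w n (z - (1, 0))])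
    `|`
    ([set w | w (z - (0, 1)) = false] `&` [set w | has_ancestor w n (z - (0, 1))]).
  apply/seteqP; split=> w.
    by move=> [y [/walk1E[] [-> wy] hy]]; [left|right].
  by move=> [[wy hy]|[wy hy]]; [exists (z - (1, 0))|exists (z - (0, 1))];
    split=> //; apply/walk1E; [left|right].
by apply: measurableU; apply: measurableI; rewrite ?ih//; exact: measurable_cylinder.
Qed.

Lemma measurable_Omega_alpha : measurable Omega_alpha.
Proof.
have -> : Omega_alpha = \bigcap_n [set w | has_ancestor w n 0].
  apply/seteqP; split=> w; first by move=> /bi_infiniteP h n _; exact: h.
  by move=> h; apply/bi_infiniteP => n; exact: h.
by apply: bigcapT_measurable => n; exact: measurable_has_ancestor.
Qed.

(* Main.v *)
Require Import Defs.
From mathcomp Require Import all_boot all_order all_algebra.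
From mathcomp Require Import finmap ring lra zify.
From mathcomp Require Import all_classical all_reals all_analysis.

Import Order.TTheory GRing.Theory Num.Theory.
Import numFieldNormedType.Exports.

Local Open Scope classical_set_scope.
Local Open Scope ring_scope.

(** If the origin is almost surely bi-infinite, it almost surely has at least
    one predecessor.  By invariance its expected number of predecessors is
    P(w(-e1) = e1) + P(w(-e2) = e2) = 1, so it almost surely has exactly one,
    which means w(-e1) = w(-e2).  By invariance again, almost every
    configuration is constant along the antidiagonals, so an m x n rectangle
    carries at most 2^(m+n) patterns of positive probability and its entropy
    is at most (m+n) ln 2 = o(mn). *)

(** * Shannon entropy of a finite distribution *)

Section Entropy.
Context {R : realType} {T : finType} (q : T -> R).
Hypothesis q_ge0 : forall t, 0 <= q t.
Hypothesis q_sum1 : \sum_t q t = 1.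

Lemma shannon_entropy_ge0 : 0 <= shannon_entropy q.
Proof.
apply: sumr_ge0 => t _; rewrite -mulrN mulr_ge0// oppr_ge0 ln_le0//.
by rewrite -q_sum1 (bigD1 t)//= lerDl sumr_ge0.
Qed.

(** Outcomes of zero probability contribute nothing, so only the support counts; this turns a
    scarcity of possible patterns into small entropy. *)
Lemma shannon_entropy_le_ln_card (N : nat) :
  (#|[pred t | q t != 0%R]| <= N)%N -> shannon_entropy q <= ln N%:R.
Proof.
move=> leN; have N0 : 0 < N%:R :> R.
  rewrite ltr0n (leq_trans _ leN)// lt0n; apply/negP => /eqP /card0_eq q0.
  have := q_sum1; rewrite big1 => [/eqP|t _]; first by rewrite eq_sym oner_eq0.
  by apply/eqP; have := q0 t; rewrite inE => /negbFE.
(* Gibbs: ln x <= x - 1 at x = 1 / (N q t). *)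
have gibbs t : - (q t * ln (q t)) <=
    q t * ln N%:R - q t + (if q t != 0 then N%:R^-1 else 0).
  have [->|qt0] := eqVneq (q t) 0; first by rewrite !mul0r !oppr0 !addr0.
  have qt : 0 < q t by rewrite lt0r qt0 q_ge0.
  have Nq : 0 < (N%:R * q t)^-1 by rewrite invr_gt0 mulr_gt0.
  have := @le_ln1Dx R ((N%:R * q t)^-1 - 1).
  rewrite (addrC 1) subrK lnV ?posrE ?mulr_gt0// lnM ?posrE//.
  move=> /(_ ltac:(lra)) /(ler_wpM2l (q_ge0 t)).
  have -> : q t * ((N%:R * q t)^-1 - 1) = N%:R^-1 - q t.
    by field; rewrite qt0 gt_eqF.
  by rewrite /= mulrN mulrDr; lra.
apply: le_trans (ler_sum _ (fun t _ => gibbs t)) _.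
(* After summation the terms [- q t] give -1, while the terms 1/N, one for each point of the
   support, give at most 1. *)
rewrite big_split/= sumrB -mulr_suml q_sum1 mul1r -big_mkcond/= sumr_const.
have : N%:R^-1 *+ #|[pred t | q t != 0]| <= 1 :> R.
  rewrite -(mulr_natl N%:R^-1) ler_pdivrMr// mul1r ler_nat; exact: leN.
by rewrite /=; lra.
Qed.

End Entropy.

(** * Marginals as finite probability distributions *)

Section Marginal.
Context {R : realType} (P : probability borel_config R).

Definition cylinder {M : {fset site}} (p : {ffun M -> arrow}) :
  set borel_config := [set w | forall x : M, w (val x) = p x].

Lemma measurable_cylinder_pattern {M : {fset site}} (p : {ffun M -> arrow}) :
  measurable (cylinder p).
Proof.
have -> : cylinder p = \bigcap_(x in [set: M]) [set w | w (val x) = p x].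
  by apply/seteqP; split=> [w wp x _|w wp x]; exact: wp.
apply: fin_bigcap_measurable; first exact: finite_finset.
by move=> x _; exact: measurable_cylinder.
Qed.

Lemma marginal_ge0 (M : {fset site}) (p : {ffun M -> arrow}) :
  0 <= marginal P p.
Proof. by rewrite fine_ge0// measure_ge0. Qed.

(** The cylinders partition the space: each configuration lies in that of its own restriction to [M]
    and in no other. *)
Lemma marginal_sum1 (M : {fset site}) :
  \sum_(p : {ffun M -> arrow}) marginal P p = 1.
Proof.
apply: EFin_inj; rewrite -sumEFin -(@probability_setT _ _ _ P).
have -> : [set: borel_config] =
    \bigcup_(p in [set: {ffun M -> arrow}]) cylinder p.
  apply/esym/seteqP; split=> // w _; exists [ffun x : M => w (val x)] => //.
  by move=> x; rewrite ffunE.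
rewrite measure_fin_bigcup; first last.
- by move=> p _; exact: measurable_cylinder_pattern.
- by move=> p p' _ _ [w [wp wp']]; apply/ffunP => x; rewrite -wp -wp'.
- exact: finite_finset.
rewrite (fsbigE (index_enum {ffun M -> arrow})) ?index_enum_uniq//; last first.
  by move=> p _; rewrite mem_index_enum.
under [RHS]eq_bigl do rewrite in_setT.
apply: eq_bigr => p _; rewrite /marginal fineK//.
by rewrite fin_num_measure//; exact: measurable_cylinder_pattern.
Qed.

End Marginal.

(** * Counting sites and patterns in a rectangle *)

Section Rectangle.

Lemma mem_rectangle c m n i j : (i < m)%N -> (j < n)%N ->
  (c.1 + i%:Z, c.2 + j%:Z) \in rectangle c m n.
Proof.
by move=> im jn; apply/imfset2P; exists i; rewrite ?mem_iota//=; exists j;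
  rewrite ?mem_iota.
Qed.

Lemma card_rectangle_ge c m n : (m * n <= #|` rectangle c m n|)%N.
Proof.
rewrite cardfE -{1}(card_ord m) -{1}(card_ord n) -card_prod.
pose g (ij : 'I_m * 'I_n) : rectangle c m n :=
  FSetSub (mem_rectangle c m n _ _ (ltn_ord ij.1) (ltn_ord ij.2)).
apply: (@leq_card _ _ g) => -[i j] [i' j'] /(congr1 val)/= [].
move=> /addrI[ii'] /addrI[jj'].
by congr pair; exact: val_inj.
Qed.

(** A pattern in [A] is determined by one bit per antidiagonal, and the coordinate sum of a site
    exceeds that of the corner [c] by i + j < m + n. *)
Lemma card_antidiagonal_patterns c m n
    (A : {pred {ffun rectangle c m n -> arrow}}) :
  (forall p x y, p \in A ->
     (val x).1 + (val x).2 = (val y).1 + (val y).2 -> p x = p y) ->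
  (#|A| <= 2 ^ (m + n))%N.
Proof.
move=> Aconst.
(* For [p] in [A], bit [k] is the common value of [p] on the k-th antidiagonal, and false if that
   antidiagonal misses the rectangle. *)
pose f (p : {ffun rectangle c m n -> arrow}) : {ffun 'I_(m + n) -> bool} :=
  [ffun k : 'I_(m + n) => [exists x : rectangle c m n,
     ((val x).1 + (val x).2 == c.1 + c.2 + k%:Z) && p x]].
have -> : (2 ^ (m + n) = #|{ffun 'I_(m + n) -> bool}|)%N.
  by rewrite card_ffun card_bool card_ord.
apply: (@leq_card_in _ _ f).
suff sub p p' x : p \in A -> p' \in A -> f p = f p' -> p x -> p' x.
  move=> p p' pA p'A fpp'; apply/ffunP => x.
  by apply/idP/idP; apply: sub.
move=> pA p'A /ffunP fpp' px.
have /imfset2P[i] := valP x; rewrite mem_iota/= => im.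
case=> j; rewrite mem_iota/= => jn xE.
have kmn : (i + j < m + n)%N by lia.
have := fpp' (Ordinal kmn); rewrite !ffunE.
have -> : [exists y : rectangle c m n,
     ((val y).1 + (val y).2 == c.1 + c.2 + (Ordinal kmn)%:Z) && p y].
  by apply/existsP; exists x; rewrite px andbT /= xE; apply/eqP => /=; lia.
move=> /esym/existsP[y /andP[/eqP yE p'y]].
rewrite (Aconst p' x y)// yE.
have -> : (val x).1 = c.1 + i%:Z by rewrite /= xE.
have -> : (val x).2 = c.2 + j%:Z by rewrite /= xE.
by rewrite /=; lia.
Qed.

End Rectangle.

(** * Almost sure constancy along antidiagonals *)

Section Antidiagonal.
Context {R : realType} (P : probability borel_config R).
Hypothesis Pinv : translation_invariant P.

Definition differ (x y : site) : set borel_config := [set w | w x <> w y].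

Lemma differE x y : differ x y =
  ([set w | w x = true] `&` [set w | w y = false]) `|`
  ([set w | w y = true] `&` [set w | w x = false]).
Proof.
apply/seteqP; split=> w; rewrite /differ /=.
  by case: (w x) (w y) => -[]; [|left|right|].
by case=> -[-> ->].
Qed.

Lemma measurable_differ x y : measurable (differ x y).
Proof.
rewrite differE.
by apply: measurableU; apply: measurableI; exact: measurable_cylinder.
Qed.

Lemma arrow_invariant x y b : P [set w | w x = b] = P [set w | w y = b].
Proof.
have -> : [set w : borel_config | w x = b] =
    Defs.shift (x - y) @^-1` [set w | w y = b].
  by apply/seteqP; split=> w; rewrite /= /Defs.shift addrC subrK.
by rewrite Pinv//; exact: measurable_cylinder.
Qed.

Lemma predecessors_agree : P Omega_alpha = 1%E ->
  P (differ (-1, 0) (0, -1)) = 0%E.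
Proof.
move=> Om1.
set x : site := (-1, 0); set y : site := (0, -1).
have mc z b : measurable ([set w | w z = b] : set borel_config).
  exact: measurable_cylinder.
(* Here both arrows that could lead to the origin point elsewhere, so the origin has no
   predecessor. *)
have orphan0 : P ([set w | w y = true] `&` [set w | w x = false]) = 0%E.
  apply: (@subset_measure0 _ _ _ P _ (~` Omega_alpha)).
  - exact: measurableI.
  - by apply: measurableC; exact: measurable_Omega_alpha.
  - move=> w [/= wy wx] [a [/walk1E a0 _]].
    case: a0 => -[->]; rewrite sub0r.
      by rewrite (_ : - _ = x)// wx.
    by rewrite (_ : - _ = y)// wy.
  - apply: etrans (probability_setC P measurable_Omega_alpha) _.
    by rewrite Om1 subee.
(* Here both arrows point to the origin. *)
have two0 : P ([set w | w x = true] `&` [set w | w y = false]) = 0%E.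
  have notE z : [set w : borel_config | w z = false] = ~` [set w | w z = true].
    by apply/seteqP; split=> w /=; case: (w z).
  (* Both sides split the probability of an arrow e_1, at [x] and at [y]; cancelling the finite
     common part equates the events of two and of no predecessors. *)
  have two_or_orphan : (P ([set w | w x = true] `&` [set w | w y = false]) +
      P ([set w | w x = true] `&` [set w | w y = true]) =
      P ([set w | w y = true] `&` [set w | w x = false]) +
      P ([set w | w x = true] `&` [set w | w y = true]))%E.
    have := arrow_invariant x y true.
    rewrite (measureDI P (mc x true) (mc y true)).
    rewrite (measureDI P (mc y true) (mc x true)) !setDE -!notE.
    by rewrite [X in (_ = _ + P X)%E -> _]setIC.
  have finI : P ([set w | w x = true] `&` [set w | w y = true]) \is a fin_num.
    by rewrite fin_num_measure//; exact: measurableI.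
  apply: etrans orphan0.
  by rewrite -[LHS](addeK _ finI) [X in (X - _)%E]two_or_orphan addeK.
rewrite differE measureU0//; exact: measurableI.
Qed.

Lemma antidiagonal_constant : P Omega_alpha = 1%E ->
  forall x y : site, x.1 + x.2 = y.1 + y.2 -> P (differ x y) = 0%E.
Proof.
move=> Om1.
(* These two sites are the possible predecessors of [z + (1, 0)]. *)
have step z : P (differ z (z + (1, -1))) = 0%E.
  have -> : differ z (z + (1, -1)) =
      Defs.shift (z + (1, 0)) @^-1` differ (-1, 0) (0, -1).
    rewrite /differ /preimage /Defs.shift /=.
    have -> : (-1, 0) + (z + (1, 0)) = z by case: z => a b; congr pair => /=; lia.
    have -> // : (0, -1) + (z + (1, 0)) = z + (1, -1).
    by case: z => a b; congr pair => /=; lia.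
  apply: etrans (Pinv _ _ _) (predecessors_agree Om1); exact: measurable_differ.
have ray (k : nat) z : P (differ z (z + (k%:Z, - k%:Z))) = 0%E.
  elim: k => [|k ih].
    rewrite (_ : differ _ _ = set0) ?measure0//.
    by apply/seteqP; split=> // w; rewrite /differ /= addr0.
  apply: (@subset_measure0 _ _ _ P _
    (differ z (z + (k%:Z, - k%:Z)) `|`
     differ (z + (k%:Z, - k%:Z)) (z + (k%:Z, - k%:Z) + (1, -1)))).
  - exact: measurable_differ.
  - by apply: measurableU; exact: measurable_differ.
  - move=> w; rewrite /differ /=.
    have -> : z + (k%:Z, - k%:Z) + (1, -1) = z + (k.+1%:Z, - k.+1%:Z).
      by case: (z) => a b; congr pair => /=; lia.
    by case: (w _) (w _) (w _) => -[] []; tauto.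
  - apply: etrans ih; apply: measureU0; last exact: step.
      exact: measurable_differ.
    exact: measurable_differ.
(* By symmetry [y] may be taken to be x + (k, -k) with k = y.1 - x.1 nonnegative, as [ray]
   requires. *)
move=> x y xy; wlog le_xy : x y xy / x.1 <= y.1.
  move=> wl; have [/wl|/ltW yx] := leP x.1 y.1; first exact.
  rewrite (_ : differ x y = differ y x); first exact: wl.
  by apply/seteqP; split=> w; rewrite /differ /= => h /esym.
have := ray `|y.1 - x.1|%N x.
congr (P (differ _ _) = _).
by case: x y xy le_xy => a b [a' b'] /= xy le_xy; congr pair => /=; lia.
Qed.

End Antidiagonal.

(** * Vanishing of the entropy rate *)

Lemma entropy_rate_eq0 (R : realType) (P : probability borel_config R)
    (Pinv : translation_invariant P) :
  P Omega_alpha = 1%E -> entropy_rate P = 0.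
Proof.
move=> Om1.
have bound c m n : shannon_entropy (@marginal R P (rectangle c m n)) <=
    ln 2 *+ (m + n).
  rewrite -lnXn// -natrX; apply: shannon_entropy_le_ln_card.
  - exact: marginal_ge0.
  - exact: marginal_sum1.
  (* A pattern with two different values on one antidiagonal has its cylinder inside a null event
     [differ]. *)
  apply: card_antidiagonal_patterns => p x y; rewrite inE => p0 xy.
  apply: contraNeq p0 => pxy; rewrite /marginal.
  suff -> : P (cylinder p) = 0%E by [].
  apply: (@subset_measure0 _ _ _ P _ (differ (val x) (val y))).
  - exact: measurable_cylinder_pattern.
  - exact: measurable_differ.
  - by move=> w wp; rewrite /differ /= !wp; exact/eqP.
  - exact: antidiagonal_constant.
(* Properness makes limits along the product filter unique, so that [lim] can be computed by
   exhibiting convergence. *)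
have pf : ProperFilter (globally [set: site]).
  exact: (@globally_properfilter _ _ 0).
rewrite /entropy_rate; set F := filter_prod _ _.
have width_oo : r.2.1 @[r --> F] --> \oo.
  by apply: cvg_comp; [exact: cvg_snd|exact: cvg_fst].
have height_oo : r.2.2 @[r --> F] --> \oo.
  by apply: cvg_comp; [exact: cvg_snd|exact: cvg_snd].
apply: cvg_lim => //.
(* The upper bound is ln 2 times (m + n) / (m n), whatever the position of the corner. *)
apply: (@squeeze_cvgr _ _ _ _ (fun=> 0) (fun r =>
    ln 2 * (r.2.1%:R^-1 + r.2.2%:R^-1))).
- near=> r.
  (* Positive sides keep the inverses below away from the default value of 1/0. *)
  have m0 : (0 < r.2.1)%N.
    by near: r; exact: (width_oo _ (nbhs_infty_gt 0)).
  have n0 : (0 < r.2.2)%N.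
    by near: r; exact: (height_oo _ (nbhs_infty_gt 0)).
  rewrite divr_ge0 ?shannon_entropy_ge0//=; last 2 first.
  + exact: marginal_ge0.
  + exact: marginal_sum1.
  have mn0 : 0 < (r.2.1 * r.2.2)%:R :> R by rewrite ltr0n muln_gt0 m0.
  apply: (@le_trans _ _ (ln 2 *+ (r.2.1 + r.2.2) / (r.2.1 * r.2.2)%:R)).
    apply: ler_pM => //.
    + by apply: shannon_entropy_ge0; [exact: marginal_ge0|exact: marginal_sum1].
    + by rewrite lef_pV2 ?posrE ?ler_nat ?card_rectangle_ge//
        (lt_le_trans mn0)// ler_nat card_rectangle_ge.
  rewrite natrM -(mulr_natr (ln 2)) natrD le_eqVlt; apply/orP; left; apply/eqP.
  by field; rewrite !pnatr_eq0 -!lt0n n0 m0.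
- by apply: cvg_cst.
- have invn : (n%:R^-1 : R) @[n --> \oo] --> 0.
    apply/gtr0_cvgV0; last exact: cvgr_idn.
    by near=> n; rewrite ltr0n; near: n; exact: nbhs_infty_gt.
  have -> : 0 = ln 2 * (0 + 0) :> R by rewrite addr0 mulr0.
  apply: cvgMr; apply: cvgD.
  + exact: cvg_comp width_oo invn.
  + exact: cvg_comp height_oo invn.
Unshelve. all: by end_near.
Qed.

Theorem theorem3p1 (R : realType) (P : probability borel_config R)
    (Pinv : translation_invariant P) (hpos : (0 < entropy_rate P)%R) :
  (P Omega_alpha < 1)%E.
Proof.
rewrite lt_neqAle probability_le1 ?andbT; last exact: measurable_Omega_alpha.
by apply: contraTneq hpos => /(entropy_rate_eq0 _ _ Pinv) ->; rewrite ltxx.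
Qed.
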